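(* For every nonnegative integer $i$ there exist a tree $G=(V,E,\ell)$ with nonnegative edge lengths and a set $R\subseteq V$ of $k=2^i$ terminals such that every distance-preserving minor $G'$ of $G$ with respect to $R$ has at least $2k-2$ vertices. In particular, $f^*(k,\mathrm{Trees})\ge 2k-2$ whenever $k$ is a power of $2$, where $\mathrm{Trees}$ is the family of all trees.
   Context: $d_H$ denotes shortest-path distance in a graph $H$ with respect to its edge lengths. Given a graph $G=(V,E,\ell)$ and terminals $R\subseteq V$, a distance-preserving minor of $G$ with respect to $R$ is a graph $G'$ with edge lengths $\ell'$ (which may differ from $\ell$) such that $G'$ is a minor of $G$ in which the terminals survive (terminals are never deleted and no two terminals are merged; a terminal may be merged with non-terminals by contraction and the resulting vertex is identified with that terminal), so $R\subseteq V(G')$, and $d_{G'}(u,v)=d_G(u,v)$ for all $u,v\in R$. For a family $\mathcal{F}$ of graphs, $f^*(k,\mathcal{F})$ is the minimum number such that every graph in $\mathcal{F}$, with any nonnegative edge lengths and any $k$ terminals, admits a distance-preserving minor with at most $f^*(k,\mathcal{F})$ vertices. *)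

(* Defs.v *)
From mathcomp Require Import all_boot all_order all_algebra.
From mathcomp Require Import all_classical all_reals ereal.

Set Implicit Arguments.
Unset Strict Implicit.
Unset Printing Implicit Defensive.

Import Order.TTheory GRing.Theory Num.Theory.

Record sgraph := SGraph {
  vertex :> finType;
  adj : rel vertex;
  adj_sym : symmetric adj;
  adj_irr : irreflexive adj
}.

(* A cycle is a cyclic sequence of at least three distinct vertices. *)
Definition is_tree (G : sgraph) : Prop :=
  [/\ (0 < #|G|)%N,
      forall u v : G, connect (@adj G) u v &
      forall c : seq G, ucycle (@adj G) c -> (size c < 3)%N].

Section Lengths.
Variable R : realType.
Local Open Scope ring_scope.
Local Open Scope classical_set_scope.

(* A length is given to ordered pairs; only its values on edges matter, and
   there it has to be symmetric. *)
Definition edge_lengths (G : sgraph) (l : G -> G -> R) : Prop :=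
  forall u v : G, adj u v -> l u v = l v u /\ 0 <= l u v.

(* The total length of the walk u :: p. *)
Definition walk_length (G : sgraph) (l : G -> G -> R) (u : G) (p : seq G) : R :=
  \sum_(x <- pairmap l u p) x.

(* The infimum over all u-v walks.  For nonnegative lengths it is attained by a
   simple path; it is +oo when v is not reachable from u. *)
Definition dist (G : sgraph) (l : G -> G -> R) (u v : G) : \bar R :=
  ereal_inf [set (walk_length l u p)%:E | p in
    [set p : seq G | path (@adj G) u p /\ last u p = v]].

End Lengths.

(* A graph some of whose vertices carry a terminal name in T.  The map term
   keeps track of the identification of terminals along minor operations. *)
Record tgraph (T : Type) := TGraph {
  graph :> sgraph;
  term : T -> graph
}.

Definition terminal (T : Type) (G : tgraph T) (x : G) : Prop :=
  exists t : T, term G t = x.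

Definition same_edge (G : sgraph) (u v x y : G) : Prop :=
  (x = u /\ y = v) \/ (x = v /\ y = u).

(* The minor operations.  The result is only determined up to isomorphism, so
   each operation is described through a map between the two vertex sets. *)
Section Operations.
Variables (T : Type) (G G' : tgraph T).

Definition edge_deletion : Prop :=
  exists (u v : G) (f : G -> G'),
    [/\ adj u v, bijective f,
        forall x y, adj (f x) (f y) <-> adj x y /\ ~ same_edge u v x y &
        forall t, term G' t = f (term G t)].

Definition vertex_deletion : Prop :=
  exists (v : G) (f : G' -> G),
    [/\ ~ terminal v, injective f,
        forall x, (exists y, f y = x) <-> x <> v,
        forall x y, adj x y = adj (f x) (f y) &
        forall t, f (term G' t) = term G t].

(* Loops are dropped and parallel edges are merged. *)
Definition edge_contraction : Prop :=
  exists (u v : G) (f : G -> G'),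
    [/\ adj u v /\ ~ (terminal u /\ terminal v),
        forall a, exists x, f x = a,
        forall x y, f x = f y <-> x = y \/ same_edge u v x y,
        forall a b, adj a b <->
          a <> b /\ exists x y, [/\ f x = a, f y = b & adj x y] &
        forall t, term G' t = f (term G t)].

Definition isomorphism : Prop :=
  exists f : G -> G',
    [/\ bijective f,
        forall x y, adj (f x) (f y) = adj x y &
        forall t, term G' t = f (term G t)].

Definition minor_step : Prop :=
  edge_deletion \/ vertex_deletion \/ edge_contraction.

End Operations.

(* term_minor G G': the graph G' is a minor of G in which the terminals
   survive. *)
Inductive term_minor (T : Type) (G : tgraph T) : tgraph T -> Prop :=
| term_minor_iso (G' : tgraph T) : isomorphism G G' -> term_minor G G'
| term_minor_step (G' G'' : tgraph T) :
    term_minor G G' -> minor_step G' G'' -> term_minor G G''.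

Definition with_terminals (G : sgraph) (K : {set G}) : tgraph {x : G | x \in K} :=
  @TGraph _ G (fun t => val t).

(* (G', l') is a distance-preserving minor of (G, l) with respect to K; the
   vertex tau t of G' is the one identified with the terminal t. *)
Definition dp_minor (R : realType) (G : sgraph) (l : G -> G -> R) (K : {set G})
    (G' : sgraph) (l' : G' -> G' -> R) : Prop :=
  edge_lengths l' /\
  exists tau : {x : G | x \in K} -> G',
    term_minor (with_terminals K) (TGraph tau) /\
    forall s t, dist l' (tau s) (tau t) = dist l (val s) (val t).

Section Fstar.
Variable R : realType.
Local Open Scope classical_set_scope.

(* Every graph in F, with any lengths and any k terminals, admits a
   distance-preserving minor with at most m vertices. *)
Definition admissible_size (k : nat) (F : sgraph -> Prop) (m : nat) : Prop :=
  forall (G : sgraph) (l : G -> G -> R) (K : {set G}),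
    F G -> edge_lengths l -> #|K| = k ->
    exists (G' : sgraph) (l' : G' -> G' -> R),
      dp_minor l K l' /\ (#|G'| <= m)%N.

(* The infimum of a set of naturals: the least admissible size if there is one,
   and +oo otherwise. *)
Definition fstar (k : nat) (F : sgraph -> Prop) : \bar R :=
  ereal_inf [set (m%:R)%:E | m in [set m : nat | admissible_size k F m]].

End Fstar.

(* Main.v *)
(** The tree is a comb with unit lengths: a spine v_0, ..., v_{k-1} with a tooth
    x_j attached to each v_j, the teeth being the terminals.  For 0 < j < k-1,
    the vertex v_j meets every walk between two of x_0, x_j, x_{k-1}.  The
    existence of a vertex meeting all walks between given pairs of terminals is
    inherited by minors, since walks lift.  The distances from such a vertex m_j
    of G' to x_0, x_j, x_{k-1} are then forced by the distances between
    terminals: m_j is at distance 1 from x_j and j+1 from x_0.  Hence the k-2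
    vertices m_j are distinct from each other and from the k terminals. *)

Require Import Defs.
From mathcomp Require Import all_boot all_order all_algebra.
From mathcomp Require Import all_classical all_reals ereal.
From mathcomp Require Import zify ring.

Set Implicit Arguments.
Unset Strict Implicit.
Unset Printing Implicit Defensive.

Import Order.TTheory GRing.Theory Num.Theory.

(** * Separating vertices pass to minors *)

Section Separators.
Variable T : Type.

Definition separates (G : tgraph T) (m : G) (s t : T) : Prop :=
  forall p, path (@adj G) (term G s) p -> last (term G s) p = term G t ->
    m \in term G s :: p.

(** A single vertex has to serve all pairs in [P]: its distances are later computed by combining
    three separations. *)
Definition has_separator (P : T -> T -> Prop) (G : tgraph T) : Prop :=
  exists m : G, forall s t, P s t -> separates m s t.

(** Consecutive lifted edges may meet a fibre of [f] in two different vertices. These are adjacent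
    by hypothesis, so one extra step joins them, and the image of the walk gains no new vertex. *)
Lemma lift_walk (G G' : sgraph) (f : G -> G') :
    (forall a b, adj a b -> exists x y, [/\ f x = a, f y = b & adj x y]) ->
    (forall x y, f x = f y -> x = y \/ adj x y) ->
  forall p x y, path (@adj G') (f x) p -> last (f x) p = f y ->
  exists q, [/\ path (@adj G) x q, last x q = y &
                {subset map f q <= f x :: p}].
Proof.
move=> lift_adj fib; elim=> [|b p IHp] x y /=.
- move=> _ fxy; have [<-|xy] := fib x y fxy; first by exists [::].
  by exists [:: y]; rewrite /= xy fxy; split.
- move=> /andP[/lift_adj[x1 [y1 [fx1 <- xy1]]]] py1 ly.
  have [q [pq lq sq]] := IHp y1 y py1 ly.
  have sq' : {subset map f (y1 :: q) <= [:: f x, f y1 & p]}.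
    move=> a; rewrite /= inE => /orP[/eqP->|/sq]; rewrite !inE ?eqxx ?orbT //.
    by move=> ->; rewrite orbT.
  have [->|xx1] := fib x x1 (esym fx1).
    exists (y1 :: q); split=> //=; first by rewrite xy1.
    by move=> a /sq'; rewrite fx1 -fx1.
  exists [:: x1, y1 & q]; split=> //=; first by rewrite xx1 xy1.
  by move=> a; rewrite inE => /orP[/eqP->|/sq'//]; rewrite fx1 mem_head.
Qed.

Lemma has_separator_image (P : T -> T -> Prop) (G G' : tgraph T) (f : G -> G') :
    (forall a b, adj a b -> exists x y, [/\ f x = a, f y = b & adj x y]) ->
    (forall x y, f x = f y -> x = y \/ adj x y) ->
    (forall t, term G' t = f (term G t)) ->
  has_separator P G -> has_separator P G'.
Proof.
move=> lift_adj fib fterm [m sepm]; exists (f m) => s t Pst p.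
rewrite !fterm => pp /(lift_walk lift_adj fib pp)[q [pq lq sq]].
have := sepm s t Pst q pq lq.
by rewrite inE => /orP[/eqP->|/(map_f f)/sq//]; rewrite mem_head.
Qed.

Lemma has_separator_bij (P : T -> T -> Prop) (G G' : tgraph T) (f : G -> G') :
    bijective f -> (forall x y, adj (f x) (f y) -> adj x y) ->
    (forall t, term G' t = f (term G t)) ->
  has_separator P G -> has_separator P G'.
Proof.
move=> [g fK gK] fadj; apply: has_separator_image => [a b ab|x y /(can_inj fK)].
  by exists (g a), (g b); split=> //; apply: fadj; rewrite !gK.
by left.
Qed.

Lemma has_separator_step (P : T -> T -> Prop) (G G' : tgraph T) (t0 : T) :
  minor_step G G' -> has_separator P G -> has_separator P G'.
Proof.
move=> [|[]].
- move=> [u [v [f [_ bijf fadj fterm]]]].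
  by apply: (has_separator_bij bijf) fterm => x y /fadj[].
- move=> [v [f [_ finj fim fadj fterm]]] [m sepm].
  have key s t p : P s t -> path (@adj G') (term G' s) p ->
      last (term G' s) p = term G' t -> m \in map f (term G' s :: p).
    move=> Pst pp lp; rewrite /= fterm; apply: (sepm s t Pst).
      by rewrite -fterm path_map (eq_path (e' := @adj G')) // => x y; rewrite /= fadj.
    by rewrite -!fterm last_map lp.
  have [[m' fm']|Nm] := pselect (exists y, f y = m).
    by exists m' => s t Pst p pp lp; rewrite -(mem_map finj) fm'; apply: key Pst _ _.
  (* The separator itself was deleted: no walk joins a pair in [P] any more, so any vertex
     separates, and [t0] supplies one. *)
  exists (term G' t0) => s t Pst p pp lp; case: Nm.
  by have /mapP[y _ ->] := key _ _ _ Pst pp lp; exists y.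
- move=> [u [v [f [[uv _] _ fib fadj fterm]]]].
  apply: has_separator_image fterm => [a b /fadj[]//|x y /fib[->|]]; first by left.
  by case=> -[-> ->]; right; rewrite // adj_sym.
Qed.

Lemma has_separator_minor (P : T -> T -> Prop) (G G' : tgraph T) (t0 : T) :
  term_minor G G' -> has_separator P G -> has_separator P G'.
Proof.
move=> GG' sepG; elim: GG' => {G'} [G' [f [bijf fadj fterm]]|G' G'' _ sepG' st].
  by apply: (has_separator_bij bijf) sepG => // x y; rewrite fadj.
exact: has_separator_step t0 st sepG'.
Qed.

End Separators.

(** * Distances through a separating vertex *)

Section Distances.
Variable R : realType.
Local Open Scope ring_scope.
Local Open Scope ereal_scope.

Lemma walk_length_cat (G : sgraph) (l : G -> G -> R) u p q :
  walk_length l u (p ++ q) = (walk_length l u p + walk_length l (last u p) q)%R.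
Proof. by rewrite /walk_length pairmap_cat big_cat. Qed.

Lemma walk_length_ge0 (G : sgraph) (l : G -> G -> R) u p :
  edge_lengths l -> path (@adj G) u p -> (0 <= walk_length l u p)%R.
Proof.
move=> l_ge0; rewrite /walk_length.
elim: p u => [|v p IHp] u /=; first by rewrite big_nil.
by move=> /andP[/l_ge0[_ luv] /IHp]; rewrite big_cons; exact: addr_ge0.
Qed.

Lemma dist_le (G : sgraph) (l : G -> G -> R) u v p :
  path (@adj G) u p -> last u p = v -> dist l u v <= (walk_length l u p)%:E.
Proof. by move=> pp lp; apply: ereal_inf_lbound; exists p. Qed.

Lemma le_dist (G : sgraph) (l : G -> G -> R) u v (x : \bar R) :
    (forall p, path (@adj G) u p -> last u p = v -> x <= (walk_length l u p)%:E) ->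
  x <= dist l u v.
Proof. by move=> xP; apply/ereal_infP => _ [p [pp lp] <-]; exact: xP. Qed.

Lemma dist_ge0 (G : sgraph) (l : G -> G -> R) u v :
  edge_lengths l -> 0 <= dist l u v.
Proof.
by move=> l_ge0; apply: le_dist => p pp _; rewrite lee_fin walk_length_ge0.
Qed.

Lemma dist_triangle (G : sgraph) (l : G -> G -> R) u v w :
  edge_lengths l -> dist l u w <= dist l u v + dist l v w.
Proof.
move=> l_ge0.
have NNy x y : dist l x y != -oo by rewrite -ltNye (lt_le_trans _ (dist_ge0 x y l_ge0)).
(* Once [dist l u v] is finite it can be moved across the inequality, so that the two infima are
   treated one after the other. *)
have [->|uvNy] := eqVneq (dist l u v) +oo; first by rewrite addye ?leey.
have fuv : dist l u v \is a fin_num by rewrite fin_numE NNy.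
rewrite addeC -leeBlDr //; apply: le_dist => q pq lq.
rewrite leeBlDr // addeC -leeBlDr //; apply: le_dist => p pp lp.
rewrite leeBlDr // -EFinD -lp -walk_length_cat; apply: dist_le.
  by rewrite cat_path pp lp.
by rewrite last_cat lp.
Qed.

Lemma dist_via (G : sgraph) (l : G -> G -> R) u v w :
    edge_lengths l ->
    (forall p, path (@adj G) u p -> last u p = w -> v \in u :: p) ->
  dist l u w = dist l u v + dist l v w.
Proof.
move=> l_ge0 sep; apply/le_anti; rewrite dist_triangle //=.
apply: le_dist => p pp lp; have vp := sep p pp lp.
case/splitPl: vp pp lp => {}p q vE; rewrite cat_path last_cat vE => /andP[pp pq] lq.
rewrite walk_length_cat vE EFinD; apply: leeD; exact: dist_le.
Qed.

(* Summing the two directions makes the symmetry of the distance superfluous. *)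
Lemma round_trip (T : Type) (G : tgraph T) (l : G -> G -> R)
    (D : T -> T -> R) (m : G) (r s t : T) :
    edge_lengths l ->
    (forall x y, dist l (term G x) (term G y) = (D x y)%:E) ->
    separates m r s -> separates m t r -> separates m t s ->
  dist l (term G r) m + dist l m (term G r) = (D r s + D t r - D t s)%:E.
Proof.
move=> l_ge0 DE.
move=> /(dist_via l_ge0) rs /(dist_via l_ge0) tr /(dist_via l_ge0) ts.
rewrite !DE in rs tr ts.
(* Summands of a real sum are finite, so the three equations can be solved in [R]. *)
have fin x y (z : R) : z%:E = x + y -> x \is a fin_num /\ y \is a fin_num.
  by move=> e; apply/andP; rewrite -fin_numD -e.
have [/fineK rm /fineK ms] := fin _ _ _ rs.
have [/fineK tm /fineK mr] := fin _ _ _ tr.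
move: rs tr ts; rewrite -rm -ms -tm -mr -!EFinD => -[->] [->] [->].
by congr EFin; ring.
Qed.

End Distances.

(** Both neighbours on a cycle of a vertex of maximal rank would be its parents, hence equal, which
    is impossible with three or more distinct vertices. *)
Lemma parent_acyclic (G : sgraph) (par : rel G) (rank : G -> nat) :
    (forall x y, adj x y -> par x y \/ par y x) ->
    (forall x y, par x y -> rank y < rank x)%N ->
    (forall x y z, par x y -> par x z -> y = z) ->
  forall c : seq G, ucycle (@adj G) c -> (size c < 3)%N.
Proof.
move=> adj_par par_rank par_uniq c /andP[cyc uc]; rewrite ltnNge; apply/negP => c3.
have [x0 x0c] : exists x, x \in c by case: c c3 {cyc uc} => // x c; exists x; rewrite mem_head.
case: (@arg_maxnP _ x0 (mem c) rank x0c) => x xc xmax.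
have up y : y \in c -> adj x y -> par x y.
  by move=> /xmax/= yx /adj_par[//|/par_rank]; rewrite ltnNge => /negP.
(* Rotated to start at [x], the cycle has the neighbours of [x] as its second and last entries. *)
have [i c' rE] := rot_to xc.
move: cyc uc c3; rewrite -(rot_cycle i) -(rot_uniq i) -(size_rot i) rE.
have {}up y : y \in x :: c' -> adj x y -> par x y by rewrite -rE mem_rot; exact: up.
case: c' up {rE} => // y c'; case/lastP: c' => // q z up.
rewrite /cycle rcons_path /= last_rcons => /andP[/andP[xy _] zx].
have zc : z \in [:: x, y & rcons q z] by rewrite !inE mem_rcons mem_head !orbT.
have -> : y = z.
  by apply: par_uniq (up z zc _); [apply: up => //; rewrite !inE eqxx orbT|rewrite adj_sym].
by rewrite mem_rcons mem_head !andbF.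
Qed.

(** * The comb with [k.+1] teeth: distances, acyclicity, separators *)

Section Comb.
Variable k : nat.
Implicit Types (u v w : 'I_k.+1 * bool) (s t j : 'I_k.+1).

(* The vertices (j, false) form the spine, and (j, true) is the tooth at j. *)
Definition comb_par : rel ('I_k.+1 * bool) :=
  fun u v => ~~ v.2 && (u.1 == v.1 + ~~ u.2 :> nat).

Definition comb_adj : rel ('I_k.+1 * bool) :=
  fun u v => comb_par u v || comb_par v u.

Lemma comb_adj_sym : symmetric comb_adj.
Proof. by move=> u v; rewrite /comb_adj orbC. Qed.

Lemma comb_adj_irr : irreflexive comb_adj.
Proof. by case=> j [] //; rewrite /comb_adj /comb_par /=; lia. Qed.

Definition comb : sgraph := SGraph comb_adj_sym comb_adj_irr.

(** This is the distance from the tooth at [s]. One of the truncated differences vanishes, so their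
    sum counts spine edges; the successor is the step off the tooth, [v.2] the step onto another
    one. At [v = (s, true)] the formula would give 2 instead of 0. *)
Definition comb_dist s v : nat :=
  if v == (s, true) then 0 else ((s - v.1) + (v.1 - s) + v.2).+1.

Lemma comb_dist_adj s u v : comb_adj u v -> comb_dist s v <= (comb_dist s u).+1.
Proof.
rewrite /comb_dist /comb_adj /comb_par -!pair_eqE /= -!val_eqE.
case: u v => [u []] [v []] /=; rewrite ?andbT ?andbF; do ?case: ifP; lia.
Qed.

Lemma comb_dist_path s u p :
  path comb_adj u p -> comb_dist s (last u p) <= comb_dist s u + size p.
Proof.
elim: p u => [|v p IHp] u /=; first by rewrite addn0.
by move=> /andP[/(comb_dist_adj s) uv /IHp]; lia.
Qed.

Lemma comb_walk s v : exists p,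
  [/\ path comb_adj (s, true) p, last (s, true) p = v & size p = comb_dist s v].
Proof.
elim: {v}(comb_dist s v) {-2}v (erefl (comb_dist s v)) => [|n IHn] v.
  by rewrite /comb_dist; case: eqP => // -> _; exists [::].
(* The walk is built from its end: the preceding vertex is the spine vertex below a tooth, the next
   spine vertex towards [s], or finally the tooth at [s]. *)
move=> dv; suff [w wv dw] : exists2 w, comb_adj w v & comb_dist s w = n.
  have [p [pp lp sp]] := IHn w dw.
  by exists (rcons p v); rewrite rcons_path last_rcons size_rcons pp lp sp dw dv wv.
move: dv; rewrite /comb_dist; case: v => [v b]; case: eqP => //= + [<-].
case: b => [vs|_].
  exists (v, false); first by rewrite /comb_adj /comb_par /= addn0 eqxx.
  by rewrite xpair_eqE andbF /=; lia.
case: (ltngtP v s) => [vs|sv|/val_inj->].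
- have vk : v.+1 < k.+1 by have := ltn_ord s; lia.
  exists (Ordinal vk, false); first by rewrite /comb_adj /comb_par /=; lia.
  by rewrite xpair_eqE andbF /=; lia.
- have vk : v.-1 < k.+1 by have := ltn_ord v; lia.
  exists (Ordinal vk, false); first by rewrite /comb_adj /comb_par /=; lia.
  by rewrite xpair_eqE andbF /=; lia.
- exists (s, true); first by rewrite /comb_adj /comb_par /=; lia.
  by rewrite eqxx; lia.
Qed.

Lemma comb_is_tree : is_tree comb.
Proof.
split=> [|u v|].
- by apply/card_gt0P; exists (ord0, true).
- have root w : connect comb_adj (ord0, true) w.
    by have [p [pp <- _]] := comb_walk ord0 w; apply/connectP; exists p.
  apply: connect_trans (root v).
  by rewrite (sym_connect_sym comb_adj_sym).
- apply: (@parent_acyclic comb comb_par (fun v => v.1 + v.2)).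
  + by move=> x y /orP.
  + by move=> [x []] [y []]; rewrite /comb_par //=; lia.
  + move=> [x b] [y []] [z []]; rewrite /comb_par //= => /eqP-> /eqP/addIn.
    by move=> /val_inj->.
Qed.

Definition teeth : {set comb} := [set v | v.2].

Lemma tooth_in s : ((s, true) : comb) \in teeth.
Proof. by rewrite inE. Qed.

Definition tooth s : {v : comb | v \in teeth} :=
  exist (fun v => v \in teeth) (s, true) (tooth_in s).

Lemma card_teeth : #|teeth| = k.+1.
Proof.
have -> : teeth = [set ((s, true) : comb) | s in 'I_k.+1].
  apply/setP => -[s b]; rewrite inE /=; apply/idP/imsetP => [|[t _ [_ ->]]//].
  by move=> /= ->; exists s.
by rewrite card_imset ?card_ord // => s t [].
Qed.

(** The three possible values tell apart the components left after removing [(j, false)]: the part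
    before [j], the part after it, and the tooth at [j]. *)
Definition comb_side j v : bool * bool := (v.1 < j, j < v.1).

Lemma comb_separator j :
  has_separator (fun x y => comb_side j (val x) != comb_side j (val y))
    (with_terminals teeth).
Proof.
exists ((j, false) : comb) => -[x xT] [y yT] /= xy p /= pp lp.
(* By contraposition: a walk avoiding [(j, false)] never changes side. *)
move: xy; rewrite -lp {lp}; apply: contraNT.
elim: p x {xT} pp => //= v p IHp u /andP[uv vp].
rewrite inE negb_or => /andP[ju jvp].
rewrite -(eqP (IHp v vp jvp)).
move: uv ju jvp; rewrite inE negb_or => + + /andP[+ _].
rewrite /comb_side /comb_adj /comb_par -!pair_eqE /= -!val_eqE.
by case: u v {IHp vp} => [u []] [v []] /=; rewrite ?xpair_eqE; lia.
Qed.

End Comb.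

(** * Unit lengths and the count of vertices in a minor *)

Section CombLengths.
Variables (R : realType) (k : nat).
Local Open Scope ring_scope.

Definition unit_length (G : sgraph) (u v : G) : R := 1.

Lemma unit_edge_lengths (G : sgraph) : edge_lengths (@unit_length G).
Proof. by move=> u v _; rewrite ler01. Qed.

Lemma walk_length_unit (G : sgraph) (u : G) p :
  walk_length (@unit_length G) u p = (size p)%:R.
Proof.
rewrite /walk_length; elim: p u => [|v p IHp] u /=; first by rewrite big_nil.
by rewrite big_cons IHp -natr1 addrC.
Qed.

Lemma dist_comb (s : 'I_k.+1) (v : comb k) :
  dist (@unit_length (comb k)) (s, true) v = ((comb_dist s v)%:R)%:E.
Proof.
apply/le_anti/andP; split.
  have [p [pp lp <-]] := comb_walk s v.
  by rewrite -(walk_length_unit (G := comb k) (s, true)); exact: dist_le.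
apply: le_dist => p pp <-; rewrite walk_length_unit lee_fin ler_nat.
by have := comb_dist_path s pp; rewrite {2}/comb_dist eqxx.
Qed.

Lemma dp_minor_comb_card (G' : sgraph) (l' : G' -> G' -> R) :
  dp_minor (@unit_length (comb k)) (teeth k) l' -> (2 * k.+1 - 2 <= #|G'|)%N.
Proof.
move=> [l'_ge0 [tau [minG' distE]]].
pose D (x y : {v : comb k | v \in teeth k}) := comb_dist (val x).1 (val y).
have DE x y : dist l' (tau x) (tau y) = ((D x y)%:R)%:E.
  rewrite distE -dist_comb; congr dist.
  by have := valP x; rewrite inE; case: (val x) => s b /= ->.
have DtE s t : D (tooth s) (tooth t) = (if s == t then 0 else ((s - t) + (t - s)).+2)%N.
  by rewrite /D /comb_dist /= xpair_eqE andbT eq_sym; case: eqP => //; lia.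
(* The inner spine vertices have indices 1 to [k - 1], hence the shift by one from ['I_k.-1]. *)
have jP (i : 'I_k.-1) : (i.+1 < k.+1)%N by have := ltn_ord i; lia.
pose spine i : 'I_k.+1 := Ordinal (jP i).
have /choice[m mP] (i : 'I_k.-1) :=
  has_separator_minor (tooth ord0) minG' (comb_separator (spine i)).
pose rt (r : 'I_k.+1) x := (dist l' (tau (tooth r)) x + dist l' x (tau (tooth r)))%E.
have rtE i r s t :
    comb_side (spine i) (r, true) != comb_side (spine i) (s, true) ->
    comb_side (spine i) (t, true) != comb_side (spine i) (r, true) ->
    comb_side (spine i) (t, true) != comb_side (spine i) (s, true) ->
  rt r (m i) = ((D (tooth r) (tooth s))%:R + (D (tooth t) (tooth r))%:R
                 - (D (tooth t) (tooth s))%:R)%:E.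
  move=> rs tr ts; rewrite /rt.
  apply: (@round_trip _ _ (TGraph tau) l' (fun x y => (D x y)%:R)) => //=; exact: mP.
(* A round trip is twice the distance [i + 2] here, and twice the distance 1 in [rt1]. The terminals
   at [ord0], [spine i] and [ord_max] lie on three different sides of [spine i]. *)
have rt0 i : rt ord0 (m i) = ((i.*2 + 4)%N%:R)%:E.
  have ik := ltn_ord i.
  rewrite (@rtE i ord0 (spine i) ord_max) /comb_side ?xpair_eqE /=; try lia.
  rewrite !DtE -!val_eqE /=.
  congr EFin; apply/eqP; rewrite subr_eq -!natrD eqr_nat.
  by do ?case: ifP; lia.
have rt1 i : rt (spine i) (m i) = (2%:R)%:E.
  have ik := ltn_ord i.
  rewrite (@rtE i (spine i) ord0 ord_max) /comb_side ?xpair_eqE /=; try lia.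
  rewrite !DtE -!val_eqE /=.
  congr EFin; apply/eqP; rewrite subr_eq -!natrD eqr_nat.
  by do ?case: ifP; lia.
pose F (x : 'I_k.+1 + 'I_k.-1) : G' :=
  match x with inl s => tau (tooth s) | inr i => m i end.
(* Round trips between terminals have length 0 or at least 6, never 2. *)
have tooth_spine s i : tau (tooth s) <> m i.
  move=> e; have := rt1 i; rewrite -e /rt !DE !DtE -EFinD -natrD => -[] /eqP.
  by rewrite eqr_nat [s == _]eq_sym; case: (spine i == s); lia.
have injF : injective F.
  move=> [s|i] [t|j] //= e.
  - congr inl; apply/eqP; have := DE (tooth s) (tooth t).
    rewrite -e DE => -[] /eqP; rewrite eqr_nat !DtE eqxx.
    by case: (s == t).
  - by case: (tooth_spine s j).
  - by case: (tooth_spine t i).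
  - congr inr; have := rt0 i; rewrite e rt0 => -[] /eqP.
    by rewrite eqr_nat => /eqP /addIn /double_inj /esym /val_inj.
(* The domain of [F] has [k.+1 + k.-1] elements; for [k = 0] the bound to be shown is 0. *)
have := leq_card F injF; rewrite card_sum !card_ord; lia.
Qed.

End CombLengths.

Theorem theorem5 (R : realType) :
  (forall i : nat,
     exists (G : sgraph) (l : G -> G -> R) (K : {set G}),
       [/\ is_tree G, edge_lengths l, #|K| = (2 ^ i)%N &
           forall (G' : sgraph) (l' : G' -> G' -> R),
             dp_minor l K l' -> (2 * 2 ^ i - 2 <= #|G'|)%N])
  /\
  (forall k : nat, (exists i : nat, k = (2 ^ i)%N) ->
     (((2 * k - 2)%N%:R)%:E <= fstar R k is_tree)%E).
Proof.
have tree i : exists (G : sgraph) (l : G -> G -> R) (K : {set G}),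
    [/\ is_tree G, edge_lengths l, #|K| = (2 ^ i)%N &
        forall (G' : sgraph) (l' : G' -> G' -> R),
          dp_minor l K l' -> (2 * 2 ^ i - 2 <= #|G'|)%N].
  (* The predecessor is taken because [comb k] has [k.+1] teeth. *)
  exists (comb (2 ^ i).-1), (@unit_length R _), (teeth _).
  have e : (2 ^ i).-1.+1 = (2 ^ i)%N by rewrite prednK // expn_gt0.
  split; first exact: comb_is_tree.
  - exact: unit_edge_lengths.
  - by rewrite card_teeth.
  - by move=> G' l' /dp_minor_comb_card; rewrite e.
split=> // _ [i ->]; have [G [l [K [treeG l_ge0 cardK sizeG']]]] := tree i.
(* An admissible size [n] applies to this very tree and so bounds the size of one of its minors. *)
apply/ereal_infP => _ [n /(_ G l K treeG l_ge0 cardK)[G' [l' [min le_n]]] <-].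
by rewrite lee_fin ler_nat (leq_trans _ le_n) // (sizeG' _ _ min).
Qed.
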